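(* Suppose the iterates $\{x^k\}_{k\in\mathbb N}$ and $\tilde\partial_{k+1}:=-M(x^{k+1}-x^k)$ satisfy the Descent Assumption (see context). Then $x^k\in\Omega_X$ and \[ \mathcal G(x^{k+1};x^k)+\eta\|x^{k+1}-x^k\|_M^2\le\varepsilon_{\mathrm{desc},k}\quad\text{for all }k\in\mathbb N, \] as well as \[ \sup_{N\in\mathbb N}\sum_{k=0}^{N-1}\|x^{k+1}-x^k\|_M^2\le\frac{C_{\mathcal G}+r_{\mathrm{desc}}}{\eta-\tilde\eta}. \] If, moreover, the Approximation Assumption (see context) holds, then also $\inf_{x^*\in H(x^{k+1})}\|x^*\|_{X^*}\to0$ as $k\to\infty$.
   Context: $X$ is a real normed space, $X^*$ its dual, $\langle x^*|x\rangle$ the dual pairing, and $\mathbb L(X;X^* )$ the bounded linear operators. An operator $M\in\mathbb L(X;X^* )$ is self-adjoint if $\langle Mx|y\rangle=\langle My|x\rangle$ for all $x,y\in X$, and positive semi-definite if $\langle Mx|x\rangle\ge0$ for all $x\in X$; then $\|x\|_M:=\sqrt{\langle Mx|x\rangle}$. We write $A\ge B$ if $\langle (A-B)x|x\rangle\ge0$ for all $x$, and $\|x\|_{\bar\Lambda}^2:=\langle\bar\Lambda x|x\rangle$. $F,G:X\to[-\infty,\infty]$ are proper, $\Xi\in\mathbb L(X;X^* )$ is skew-adjoint ($\langle\Xi x|y\rangle=-\langle\Xi y|x\rangle$), and $H(x):=F'(x)+\partial G(x)+\Xi x\subset X^*$, where $F'$ is the Fréchet derivative and $\partial G$ the convex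 subdifferential. The Lagrangian gap functional is \[ \mathcal G(x;\bar x):=[F+G](x)-[F+G](\bar x)-\langle\Xi x|\bar x\rangle . \] The iterates $x^k\in X$, $k\in\mathbb N=\{0,1,2,\ldots\}$, are such that $\tilde\partial_{k+1}:=-M(x^{k+1}-x^k)$ is regarded as an approximation of an element of $F'(x^k)+\partial G(x^{k+1})+\Xi x^{k+1}$ (the quality of the approximation being quantified only through the following assumptions). Descent Assumption: $M\in\mathbb L(X;X^* )$ is self-adjoint and positive semi-definite, and there are a set $\Omega_X\subset X$, $\eta>0$, $\bar\Lambda\in\mathbb L(X;X^* )$ with $\bar\Lambda\le2(1-\eta)M$, errors $\varepsilon_{\mathrm{desc},k}\in\mathbb R$, and $r_{\mathrm{desc}}<\infty$ such that: (i) for any $k\in\mathbb N$, whenever $\{x^n\}_{n=0}^k\subset\Omega_X$, we have $\langle\tilde\partial_{k+1}|x^{k+1}-x^k\rangle\ge\mathcal G(x^{k+1};x^k)-\frac12\|x^{k+1}-x^k\|_{\bar\Lambda}^2-\varepsilon_{\mathrm{desc},k}$; (ii) $\sup_{N\in\mathbb N}\sum_{k=0}^{N-1}\varepsilon_{\mathrm{desc},k}\le r_{\mathrm{desc}}$; (iii) $x^0\in\Omega_X$, and for any $N\ge1$, $\sum_{k=0}^{N-1}\mathcal G(x^{k+1};x^k)\le r_{\mathrm{desc}}$ implies $x^N\in\Omega_X$; (iv) for some $0\le\tilde\eta<\eta$, $\inf_{N\in\mathbb N}\sum_{k=0}^{N-1}\bigl(\mathcal G(x^{k+1};x^k)+\tilde\eta\|x^{k+1}-x^k\|_M^2\bigr)=:-C_{\mathcal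 G}>-\infty$. Approximation Assumption: $\sup_{N\in\mathbb N}\sum_{k=0}^{N-1}\|x^{k+1}-x^k\|_M^2<\infty$ implies $\lim_{k\to\infty}\inf_{x_{k+1}^*\in H(x^{k+1})}\|x_{k+1}^*-\tilde\partial_{k+1}\|_{X^*}^2=0$. *)

(* Defs.v *)
From HB Require Import structures.
From mathcomp Require Import all_boot all_order all_algebra.
From mathcomp Require Import all_classical all_reals all_analysis.

Set Implicit Arguments.
Unset Strict Implicit.
Unset Printing Implicit Defensive.

Import Order.TTheory GRing.Theory Num.Theory.
Import numFieldNormedType.Exports.

Local Open Scope classical_set_scope.
Local Open Scope ring_scope.

Section BoundedOperators.
Context {R : realType} (X Y : normedModType R).

Definition bounded_linear : {pred X -> Y} :=
  [pred f | `[< linear f /\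
                exists C : R, forall x : X, `|f x| <= C * `|x| >]].

Lemma bounded_linear_submod_closed : submod_closed bounded_linear.
Proof.
split.
  apply/asboolP; split; first by move=> a u v; rewrite /= scaler0 addr0.
  by exists 0 => x; rewrite mul0r normr0.
move=> a f g /asboolP[lf [C fC]] /asboolP[lg [D gD]]; apply/asboolP; split.
  move=> b u v; rewrite !fctE lf lg !scalerDr !scalerA (mulrC a b).
  by rewrite -!addrA; congr (_ + _); rewrite addrCA.
exists (`|a| * C + D) => x; rewrite !fctE (le_trans (ler_normD _ _))//.
by rewrite normrZ mulrDl -mulrA lerD// ler_wpM2l.
Qed.

HB.instance Definition _ := GRing.isSubmodClosed.Build R (X -> Y)
  bounded_linear bounded_linear_submod_closed.

(* the space L(X;Y), normed by the operator norm *)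
Record bop := Bop { bop_fun :> X -> Y; _ : bop_fun \in bounded_linear }.

HB.instance Definition _ := [isSub for bop_fun].
HB.instance Definition _ := [Choice of bop by <:].
HB.instance Definition _ := [SubChoice_isSubLmodule of bop by <:].

Lemma bop_is_linear (f : bop) : linear f.
Proof. by case: f => f /= /asboolP[]. Qed.

HB.instance Definition _ (f : bop) :=
  GRing.isLinear.Build R X Y *:%R f (@bop_is_linear f).

Lemma bop_bounded (f : bop) : exists C : R, forall x : X, `|f x| <= C * `|x|.
Proof. by case: f => f /= /asboolP[]. Qed.

Lemma bopP (f g : bop) : f =1 g -> f = g.
Proof. by move=> fg; apply: val_inj; apply/funext. Qed.

Definition opnorm (f : bop) : R := sup [set `|f x| | x in [set x | `|x| <= 1]].

Lemma opnorm_has_sup (f : bop) :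
  has_sup [set `|f x| | x in [set x | `|x| <= 1]].
Proof.
split; first by exists `|f 0|, 0 => //=; rewrite normr0.
have [C fC] := bop_bounded f; exists `|C| => _ [x /= x1 <-].
rewrite (le_trans (fC x))// (le_trans (ler_norm _))// normrM normr_id.
by rewrite ler_piMr.
Qed.

Lemma opnorm_ub (f : bop) (x : X) : `|x| <= 1 -> `|f x| <= opnorm f.
Proof.
by move=> x1; apply: ub_le_sup; [case: (opnorm_has_sup f)|exists x].
Qed.

Lemma opnorm_least (f : bop) (c : R) :
  (forall x, `|x| <= 1 -> `|f x| <= c) -> opnorm f <= c.
Proof.
move=> fc; apply: ge_sup; first by case: (opnorm_has_sup f).
by move=> _ [x /= x1 <-]; exact: fc.
Qed.

Lemma opnorm_ge0 (f : bop) : 0 <= opnorm f.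
Proof. by rewrite (le_trans _ (@opnorm_ub f 0 _))// normr0. Qed.

Lemma opnormP (f : bop) (x : X) : `|f x| <= opnorm f * `|x|.
Proof.
have [->|x0] := eqVneq x 0; first by rewrite linear0 !normr0 mulr0.
have nx0 : 0 < `|x| by rewrite normr_gt0.
rewrite -ler_pdivrMr// mulrC -[leLHS](_ : `|f (`|x|^-1 *: x)| = _).
  by rewrite opnorm_ub// normrZ ger0_norm ?invr_ge0// mulVf ?gt_eqF.
by rewrite linearZ normrZ ger0_norm ?invr_ge0.
Qed.

Lemma opnormD (f g : bop) : opnorm (f + g) <= opnorm f + opnorm g.
Proof.
apply: opnorm_least => x x1; rewrite (le_trans (ler_normD _ _))//.
by rewrite lerD// opnorm_ub.
Qed.

Lemma opnormZ (a : R) (f : bop) : opnorm (a *: f) = `|a| * opnorm f.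
Proof.
have le b g : opnorm (b *: g) <= `|b| * opnorm g.
  by apply: opnorm_least => x x1; rewrite normrZ ler_wpM2l// opnorm_ub.
apply/eqP; rewrite eq_le le/=; have [->|a0] := eqVneq a 0.
  by rewrite normr0 mul0r opnorm_ge0.
rewrite -ler_pdivlMl ?normr_gt0// -normfV.
rewrite -[leLHS](_ : opnorm (a^-1 *: (a *: f)) = _)//.
by rewrite scalerA mulVf// scale1r.
Qed.

Lemma opnorm_eq0 (f : bop) : opnorm f = 0 -> f = 0.
Proof.
move=> f0; apply: bopP => x; apply/eqP; rewrite -normr_le0.
by rewrite (le_trans (opnormP f x))// f0 mul0r.
Qed.

HB.instance Definition _ :=
  Lmodule_isNormed.Build R bop opnormD opnormZ opnorm_eq0.

End BoundedOperators.

Notation "''L' ( X ; Y )" := (bop X Y)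
  (at level 8, X at level 99, Y at level 99, format "''L' ( X ;  Y )").

Section Problem.
Context {R : realType} {X : normedModType R}.

(* X^* is 'L(X; R^o), and the dual pairing <x^*|x> is the application x^* x. *)
Implicit Types (A B M Xi : 'L(X; 'L(X; R^o))) (F G : X -> \bar R).

Definition self_adjoint M := forall x y, M x y = M y x.

Definition skew_adjoint Xi := forall x y, Xi x y = - Xi y x.

Definition positive_semidefinite M := forall x, 0 <= M x x.

Definition op_le A B := positive_semidefinite (B - A).

Definition quad A (x : X) : R := A x x.

(* ||x||_M, for M positive semidefinite; ||x||_A^2 is quad A x in general *)
Definition opseminorm M (x : X) : R := Num.sqrt (quad M x).

Definition proper_fun F := (forall x, -oo < F x)%E /\ exists x, (F x < +oo)%E.

Definition is_frechet_derivative F (x : X) (d : 'L(X; R^o)) : Prop :=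
  (\forall y \near x, F y \is a fin_num) /\
  is_diff x (fine \o F : X -> R^o) d.

Definition subdifferential G (x : X) : set 'L(X; R^o) :=
  [set g : 'L(X; R^o) | forall y, (G x + (g (y - x))%:E <= G y)%E].

(* F' is not assumed to exist everywhere: Hmap F G Xi x is empty when F is not
   Fréchet differentiable at x. *)
Definition Hmap F G Xi (x : X) : set 'L(X; R^o) :=
  [set d + g + Xi x | d in is_frechet_derivative F x &
                      g in subdifferential G x].

(* The infinite values are subtracted as in \bar R, where +oo - +oo = -oo;
   the clause descent_gap_inf below, with F and G proper, makes F and G finite
   at all iterates, so that this convention is immaterial there. *)
Definition lagrangian_gap F G Xi (x xb : X) : \bar R :=
  ((F x + G x) - (F xb + G xb) - (Xi x xb)%:E)%E.

(* dtilde M x k approximates an element of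
   F' (x k) + subdifferential G (x k.+1) + Xi (x k.+1), hence its index k + 1
   in the mathematical notation. *)
Definition dtilde M (x : nat -> X) (k : nat) : 'L(X; R^o) :=
  - M (x k.+1 - x k).

Record descent_assumption F G Xi M (x : nat -> X) (Omega : set X) (eta : R)
    (Lambda : 'L(X; 'L(X; R^o))) (eps : nat -> R) (rdesc etat CG : R) : Prop :=
  DescentAssumption {
  descent_self_adjoint : self_adjoint M ;
  descent_psd : positive_semidefinite M ;
  descent_eta_gt0 : 0 < eta ;
  descent_Lambda_le : op_le Lambda ((2 * (1 - eta)) *: M) ;
  descent_inequality : forall k, (forall n, (n <= k)%N -> Omega (x n)) ->
    (lagrangian_gap F G Xi (x k.+1) (x k)
       - (2^-1 * quad Lambda (x k.+1 - x k))%:E - (eps k)%:E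
     <= (dtilde M x k (x k.+1 - x k))%:E)%E ;
  descent_errors :
    (ereal_sup (range (fun N => (\sum_(0 <= k < N) eps k)%:E)) <= rdesc%:E)%E ;
  descent_init : Omega (x 0%N) ;
  descent_stay : forall N, (1 <= N)%N ->
    (\sum_(0 <= k < N) lagrangian_gap F G Xi (x k.+1) (x k) <= rdesc%:E)%E ->
    Omega (x N) ;
  descent_etat_ge0 : 0 <= etat ;
  descent_etat_lt : etat < eta ;
  (* a real CG renders the requirement that this infimum be > -oo; taking
     N = 0 shows that it is never +oo *)
  descent_gap_inf :
    ereal_inf (range (fun N => (\sum_(0 <= k < N)
      (lagrangian_gap F G Xi (x k.+1) (x k)
         + (etat * opseminorm M (x k.+1 - x k) ^+ 2)%:E))%E)) = (- CG)%:E
}.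

Definition sum_sq_steps M (x : nat -> X) : \bar R :=
  ereal_sup (range (fun N =>
    (\sum_(0 <= k < N) opseminorm M (x k.+1 - x k) ^+ 2)%:E)).

Definition approximation_assumption F G Xi M (x : nat -> X) : Prop :=
  (sum_sq_steps M x < +oo)%E ->
  (fun k => ereal_inf [set (`|xs - dtilde M x k| ^+ 2)%:E |
                        xs in Hmap F G Xi (x k.+1)]) @ \oo --> 0%E.

End Problem.

(* Main.v *)
Require Import Defs.
From mathcomp Require Import all_boot all_order all_algebra.
From mathcomp Require Import all_classical all_reals all_analysis.
From mathcomp Require Import ring lra.

Import Order.TTheory GRing.Theory Num.Theory.
Import numFieldNormedType.Exports.

Local Open Scope classical_set_scope.
Local Open Scope ring_scope.

(**
   With d = x^{k+1} - x^k, the pairing <- M d | d> in the descent inequality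
   equals - ||d||_M^2, while Lambda <= 2 (1 - eta) M bounds the
   curvature term by (1 - eta) ||d||_M^2.  What remains is the one-step estimate
     gap_k + eta ||d||_M^2 <= eps_k                          ([descent_step]),
   valid as long as the iterates up to k lie in Omega.  Since it implies
   gap_k <= eps_k, summing it bounds the accumulated gap by rdesc, which is
   exactly what keeps the next iterate in Omega; strong induction thus removes
   the proviso ([iterates_in_Omega]).  Splitting eta = etat + (eta - etat) and
   summing once more, the part with etat is bounded below by - CG and the other
   part is the sum of squared steps ([sum_sqstep_le]).

   For the last claim, summability gives ||x^{k+1} - x^k||_M -> 0.  This is only
   a seminorm, but the Cauchy-Schwarz inequality for the form of M gives
     ||M d|| <= sqrt(||M||) ||d||_M                          ([psd_norm_le]),
   so the approximate subgradients -M (x^{k+1} - x^k) tend to 0 in the dual.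
   As elements of H(x^{k+1}) come arbitrarily close to them, the triangle
   inequality makes the distance from 0 to H(x^{k+1}) vanish
   ([ereal_inf_norm_cvg0]).
*)

(** * Operators defining positive semidefinite forms *)

Lemma sqr_opseminorm (R : realType) (X : normedModType R)
    (M : 'L(X; 'L(X; R^o))) (d : X) :
  positive_semidefinite M -> opseminorm M d ^+ 2 = quad M d.
Proof. by move=> psdM; rewrite sqr_sqrtr//; exact: psdM. Qed.

(** The quadratic t |-> <M (t d + y) | t d + y> is nonnegative, hence has
    discriminant <= 0.  The criterion holds for degree at most 2, which covers
    the degenerate case <M d | d> = 0. *)
Lemma psd_cauchy_schwarz (R : realType) (X : normedModType R)
    (M : 'L(X; 'L(X; R^o))) (d y : X) :
  self_adjoint M -> positive_semidefinite M ->
  (M d y) ^+ 2 <= quad M d * quad M y.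
Proof.
move=> saM psdM; pose p : {poly R} := Poly [:: quad M y; 2 * M d y; quad M d].
have p_ge0 t : 0 <= p.[t].
  have lin z : M (t *: d + y) z = t * M d z + M y z.
    by rewrite saM linearD linearZ /= (saM z d) (saM z y).
  rewrite (_ : p.[t] = M (t *: d + y) (t *: d + y)); first exact: psdM.
  rewrite lin (saM d) (saM y) !lin (saM y d) horner_Poly /= /quad; ring.
have size_p : (size p <= 3)%N := size_Poly _.
have := deg_le2_poly_ge0 size_p p_ge0.
rewrite !coef_Poly /= => ?; lra.
Qed.

(** Smallness in the seminorm of M, which may vanish on nonzero vectors, still
    forces smallness of M d in the dual norm: apply Cauchy-Schwarz against the
    y in the unit ball, where <M y | y> <= ||M||. *)
Lemma psd_norm_le (R : realType) (X : normedModType R)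
    (M : 'L(X; 'L(X; R^o))) (d : X) :
  self_adjoint M -> positive_semidefinite M ->
  `|M d| <= Num.sqrt `|M| * opseminorm M d.
Proof.
move=> saM psdM; apply: opnorm_least => y y1.
rewrite /opseminorm -sqrtrM// -sqrtr_sqr ler_wsqrtr//.
rewrite (le_trans (psd_cauchy_schwarz _ _ _ d y saM psdM))// mulrC.
rewrite ler_wpM2r//; first exact: psdM.
rewrite /quad (le_trans (ler_norm _))// (le_trans (opnormP _ _))//.
rewrite (le_trans (ler_piMr _ y1))//; first exact: opnorm_ge0.
exact: (opnorm_ub M).
Qed.

Lemma op_le_quad (R : realType) (X : normedModType R)
    (A B : 'L(X; 'L(X; R^o))) (a : R) (d : X) :
  op_le A (a *: B) -> quad A d <= a * quad B d.
Proof.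
move=> /(_ d).
have -> : (a *: B - A) d = (a *: B) d - A d by [].
have -> : ((a *: B) d - A d) d = (a *: B) d d - A d d by [].
have -> : (a *: B) d = a *: B d by [].
have -> : (a *: B d) d = a * B d d by [].
by rewrite subr_ge0.
Qed.

(** * Vanishing sequences *)

(** Eventual finiteness is automatic here: it follows from being < 1. *)
Lemma cvge0P (R : realType) (u : nat -> \bar R) : (forall k, 0 <= u k)%E ->
  u @ \oo --> 0%E <-> forall e : R, 0 < e -> \forall k \near \oo, (u k < e%:E)%E.
Proof.
move=> u_ge0; split.
  move=> /fine_cvgP[ufin /cvgr0Pnorm_lt u0] e e0; near=> k.
  have uk_fin : u k \is a fin_num by near: k.
  rewrite -(fineK uk_fin) lte_fin (le_lt_trans (ler_norm _))//.
  by near: k; exact: u0.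
move=> u0; apply/fine_cvgP; split.
  near=> k; rewrite ge0_fin_numE// (@lt_trans _ _ 1%:E)%E ?ltry//.
  by near: k; exact: u0.
apply/cvgr0Pnorm_lt => e e0; near=> k.
have uk : (u k < e%:E)%E by near: k; exact: u0.
rewrite /= ger0_norm ?fine_ge0// -lte_fin fineK//.
by rewrite ge0_fin_numE// (lt_trans uk)// ltry.
Unshelve. all: by end_near.
Qed.

Lemma cvg0_of_bounded_sums (R : realType) (u : nat -> R) :
  (forall k, 0 <= u k) ->
  (ereal_sup (range (fun N => (\sum_(0 <= k < N) u k)%:E)) < +oo)%E ->
  u @ \oo --> 0.
Proof.
move=> u_ge0 sup_lty; apply: cvg_series_cvg_0; apply: nondecreasing_is_cvgn.
  exact: nondecreasing_series.
have sup_ge N : ((\sum_(0 <= k < N) u k)%:E <=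
    ereal_sup (range (fun N => (\sum_(0 <= k < N) u k)%:E)))%E.
  by apply: ereal_sup_ubound; exists N.
have sup_fin : ereal_sup (range (fun N => (\sum_(0 <= k < N) u k)%:E))
    \is a fin_num.
  rewrite ge0_fin_numE// (le_trans _ (sup_ge 0%N))//.
  by rewrite big_geq.
exists (fine (ereal_sup (range (fun N => (\sum_(0 <= k < N) u k)%:E)))).
by move=> _ [N _ <-]; rewrite /= -lee_fin fineK// sup_ge.
Qed.

(** Summable squared seminorms tend to 0, hence so do the seminorms, and the
    dual norms are controlled by them. *)
Lemma step_norm_cvg0 (R : realType) (X : normedModType R)
    (M : 'L(X; 'L(X; R^o))) (x : nat -> X) :
  self_adjoint M -> positive_semidefinite M -> (sum_sq_steps M x < +oo)%E ->
  (fun k => `|dtilde M x k|) @ \oo --> 0.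
Proof.
move=> saM psdM sumM.
have q0 : (fun k => opseminorm M (x k.+1 - x k)) @ \oo --> 0.
  have := cvg0_of_bounded_sums _ _ (fun k => sqr_ge0 _) sumM.
  move=> /(continuous_cvg _ (@sqrt_continuous R 0)) /=.
  rewrite sqrtr0; apply: cvg_trans; apply: near_eq_cvg; near=> k.
  by rewrite /= sqrtr_sqr ger0_norm// sqrtr_ge0.
apply: (@squeeze_cvgr _ _ _ _ (fun=> 0) (fun k => Num.sqrt `|M| *
  opseminorm M (x k.+1 - x k))).
- near=> k; rewrite normr_ge0 /= normrN; exact: psd_norm_le.
- exact: cvg_cst.
- by rewrite -(mulr0 (Num.sqrt `|M|)); apply: cvgMr.
Unshelve. all: by end_near.
Qed.

(** Once the infimum of squared distances is below (e/2)^2, some v in H k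
    satisfies |v - d k| < e/2, and then |v| < e as soon as |d k| < e/2.  The
    first hypothesis alone makes H k nonempty for all large k, the infimum over
    the empty set being +oo. *)
Lemma ereal_inf_norm_cvg0 (R : realType) (V : normedModType R)
    (H : nat -> set V) (d : nat -> V) :
  (fun k => ereal_inf [set (`|v - d k| ^+ 2)%:E | v in H k]) @ \oo --> 0%E ->
  (fun k => `|d k|) @ \oo --> 0 ->
  (fun k => ereal_inf [set `|v|%:E | v in H k]) @ \oo --> 0%E.
Proof.
move=> /cvge0P Hd /cvgr0Pnorm_lt d0; apply/cvge0P.
  by move=> k; apply: le_ereal_inf_tmp => _ [v _ <-]; rewrite lee_fin.
move=> e e0; have e2 : 0 < e / 2 by rewrite divr_gt0.
near=> k.
have : (ereal_inf [set (`|v - d k| ^+ 2)%:E | v in H k] < ((e / 2) ^+ 2)%:E)%E.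
  near: k; apply: Hd; last by rewrite exprn_gt0.
  by move=> k; apply: le_ereal_inf_tmp => _ [v _ <-]; rewrite lee_fin sqr_ge0.
move=> /ereal_inf_lt[_ [v Hv <-]]; rewrite lte_fin.
rewrite ltr_pXn2r ?nnegrE ?normr_ge0 ?(ltW e2)// => vd.
have dk : `|d k| < e / 2.
  by rewrite -[`|d k|]normr_id; near: k; exact: d0.
apply: (@le_lt_trans _ _ `|v|%:E).
  by apply: ereal_inf_lbound; exists v.
rewrite lte_fin -[v](subrK (d k)) (le_lt_trans (ler_normD _ _))//.
by rewrite [e]splitr ltrD.
Unshelve. all: by end_near.
Qed.

(** * The descent argument *)

Section Descent.
Context {R : realType} {X : normedModType R}.
Context {F G : X -> \bar R} {Xi M : 'L(X; 'L(X; R^o))} {x : nat -> X}.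
Context {Omega : set X} {eta : R} {Lambda : 'L(X; 'L(X; R^o))}.
Context {eps : nat -> R} {rdesc etat CG : R}.
Context (descent : descent_assumption F G Xi M x Omega eta Lambda eps
                     rdesc etat CG).

Let gap k := lagrangian_gap F G Xi (x k.+1) (x k).
Let sqstep k := opseminorm M (x k.+1 - x k) ^+ 2.

(** Only finite quantities are moved across the inequality, so the estimate also
    holds for infinite gaps: a gap of +oo contradicts the descent inequality,
    and for a gap of -oo there is nothing to prove. *)
Lemma descent_step k : (forall n, (n <= k)%N -> Omega (x n)) ->
  (gap k + (eta * sqstep k)%:E <= (eps k)%:E)%E.
Proof.
move=> Om; have psdM := descent_psd descent.
have dtildeE : dtilde M x k (x k.+1 - x k) = - quad M (x k.+1 - x k).
  by [].
have LambdaM : quad Lambda (x k.+1 - x k) <=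
    2 * (1 - eta) * quad M (x k.+1 - x k).
  exact: op_le_quad (descent_Lambda_le descent).
have := descent_inequality descent Om.
rewrite dtildeE /sqstep (sqr_opseminorm _ _ _ _ psdM) -/(gap k).
move: LambdaM; move: (quad M _) (quad Lambda _) => q l LambdaM.
case: (gap k) => [g| |]//=.
  rewrite -?EFinB -?EFinD ?lee_fin; lra.
by move=> _; rewrite addNye leNye.
Qed.

Lemma sum_eps_le N : \sum_(0 <= k < N) eps k <= rdesc.
Proof.
rewrite -lee_fin (le_trans _ (descent_errors descent))//.
by apply: ereal_sup_ubound; exists N.
Qed.

(** The iterates up to k being in Omega bounds the gaps up to k by the errors,
    whose sums never exceed rdesc; the invariance of Omega then yields the next
    iterate. *)
Lemma iterates_in_Omega k : Omega (x k).
Proof.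
elim/ltn_ind: k => -[_|k IH]; first exact: (descent_init descent).
apply: (descent_stay descent) => //.
rewrite (@le_trans _ _ (\sum_(0 <= i < k.+1) eps i)%:E)//; last first.
  by rewrite lee_fin sum_eps_le.
rewrite -sumEFin big_nat [leRHS]big_nat; apply: lee_sum => i /andP[_ ik].
rewrite (le_trans _ (descent_step i _))//; last first.
  by move=> n ni; apply: IH; rewrite ltnS (leq_trans ni).
rewrite leeDl// lee_fin mulr_ge0// ?sqr_ge0//.
exact: ltW (descent_eta_gt0 descent).
Qed.

(** The gap sums with weight etat are at least - CG, and with weight eta at most
    rdesc; the difference of the two is (eta - etat) times the claimed sum. *)
Lemma sum_sqstep_le N :
  \sum_(0 <= k < N) sqstep k <= (CG + rdesc) / (eta - etat).
Proof.
have eta_gt : 0 < eta - etat by rewrite subr_gt0 (descent_etat_lt descent).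
rewrite ler_pdivlMr// mulrC.
have lower : ((- CG)%:E <=
    \sum_(0 <= k < N) (gap k + (etat * sqstep k)%:E)%E)%E.
  by rewrite -(descent_gap_inf descent); apply: ereal_inf_lbound; exists N.
have upper : (\sum_(0 <= k < N) (gap k + (etat * sqstep k)%:E) +
    ((eta - etat) * \sum_(0 <= k < N) sqstep k)%:E <= rdesc%:E)%E.
  rewrite (@le_trans _ _ (\sum_(0 <= i < N) eps i)%:E)//; last first.
    by rewrite lee_fin sum_eps_le.
  rewrite mulr_sumr -!sumEFin -big_split /=; apply: lee_sum => i _.
  rewrite -addeA -EFinD -mulrDl addrCA subrr addr0.
  by apply: descent_step => n _; exact: iterates_in_Omega.
have := le_trans (leeD2r _ lower) upper.
by rewrite -EFinD lee_fin -lerBrDl opprK addrC [rdesc + _]addrC.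
Qed.

End Descent.

Theorem theorem5p10 (R : realType) (X : normedModType R)
    (F G : X -> \bar R) (properF : proper_fun F) (properG : proper_fun G)
    (Xi : 'L(X; 'L(X; R^o))) (skewXi : skew_adjoint Xi)
    (M : 'L(X; 'L(X; R^o))) (x : nat -> X)
    (Omega : set X) (eta : R) (Lambda : 'L(X; 'L(X; R^o)))
    (eps : nat -> R) (rdesc etat CG : R)
    (descent : descent_assumption F G Xi M x Omega eta Lambda eps
                 rdesc etat CG) :
  (forall k, Omega (x k) /\
    (lagrangian_gap F G Xi (x k.+1) (x k)
       + (eta * opseminorm M (x k.+1 - x k) ^+ 2)%:E <= (eps k)%:E)%E) /\
  (ereal_sup (range (fun N =>
     (\sum_(0 <= k < N) opseminorm M (x k.+1 - x k) ^+ 2)%:E))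
     <= ((CG + rdesc) / (eta - etat))%:E)%E /\
  (approximation_assumption F G Xi M x ->
    (fun k => ereal_inf [set `|xs|%:E | xs in Hmap F G Xi (x k.+1)])
      @ \oo --> 0%E).
Proof.
have inOmega := iterates_in_Omega descent.
have sum_le : (sum_sq_steps M x <= ((CG + rdesc) / (eta - etat))%:E)%E.
  apply: ge_ereal_sup => _ [N _ <-]; rewrite lee_fin.
  exact: sum_sqstep_le descent N.
split; [|split=> //].
  move=> k; split=> //.
  by apply: (descent_step descent) => n _; exact: inOmega.
move=> approx; have sum_fin := le_lt_trans sum_le (ltry _).
apply: (ereal_inf_norm_cvg0 _ _ (fun k => Hmap F G Xi (x k.+1)) _
  (approx sum_fin)).
apply: step_norm_cvg0 sum_fin.
  exact: descent_self_adjoint descent.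
exact: descent_psd descent.
Qed.
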